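(* Let $m \ge 1$ and let $d_1,\dots,d_m$ be positive integers with $\gcd(d_1,\dots,d_m)=1$. Let $S=\langle d_1,\dots,d_m\rangle$ be the numerical semigroup they generate, with gap set $\Delta=\mathbb{Z}_{\ge 0}\setminus S$ (finite), and let $Q_S(z)$, $\mathcal{C}_n(S)$, $K_p(S)$, $G_r(S)$, $\pi_m$, $\sigma_k$, $\delta_k$ and $T_n$ be as in the context. Then for every integer $p \ge 0$, \[ K_p(S) = \sum_{r=0}^p \binom{p}{r} T_{p-r}(\sigma)\, G_r(S) + \frac{2^{p+1}}{p+1}\, T_{p+1}(\delta). \]
   Context: The semigroup $S=\langle d_1,\dots,d_m\rangle$ is the set of all non-negative integer combinations of $d_1,\dots,d_m$ (so $0\in S$). Its Hilbert series is $H_S(z)=\sum_{s\in S} z^s$, and the Hilbert numerator is the polynomial $Q_S(z)\in\mathbb{Z}[z]$ defined by $H_S(z)=Q_S(z)/\prod_{i=1}^m(1-z^{d_i})$. Writing $1-Q_S(z)=\sum_{k\ge 0} c_k z^k$, define for $n\ge 0$ the alternating syzygy power sums $\mathcal{C}_n(S)=\sum_{k\ge 0} k^n c_k$ (with the convention $0^0=1$). Let $\pi_m=d_1 d_2\cdots d_m$, and for $p\ge 0$ define \[K_p(S)=\frac{\mathcal{C}_{m+p}(S)}{(-1)^m\,\pi_m\,\frac{(m+p)!}{p!}}.\] The gap power sums are $G_r(S)=\sum_{g\in\Delta} g^r$ for $r\ge 0$. Let $\sigma_k=\sum_{i=1}^m d_i^k$ and $\delta_k=(\sigma_k-1)/2^k$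 for $k\ge1$. The universal symmetric polynomials: for each $n\ge 0$, $T_n\in\mathbb{Q}[s_1,\dots,s_n]$ is the unique polynomial such that for every $M\ge1$ and all (indeterminates) $x_1,\dots,x_M$, one has $T_n\big(\sum_i x_i,\sum_i x_i^2,\dots,\sum_i x_i^n\big)= n!\,[t^n]\prod_{i=1}^M \frac{e^{x_i t}-1}{x_i t}$ (coefficient extraction in the formal power series ring in $t$). Then $T_n(\sigma)$ means $T_n(\sigma_1,\dots,\sigma_n)$ and $T_n(\delta)$ means $T_n(\delta_1,\dots,\delta_n)$. For example $T_0=1$, $T_1=s_1/2$, $T_2=(3s_1^2+s_2)/12$. *)

(* Defs.v *)
From mathcomp Require Import all_boot all_order all_algebra.
From mathcomp Require Import boolp classical_sets fsbigop.
From mathcomp Require Import mpoly.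

Set Implicit Arguments.
Unset Strict Implicit.
Unset Printing Implicit Defensive.

Import GRing.Theory.
Local Open Scope ring_scope.

(* A formal power series over R is its coefficient sequence nat -> R. *)

Definition fps_one (R : comNzRingType) : nat -> R := fun n => (n == 0%N)%:R.

Definition fps_mul (R : comNzRingType) (f g : nat -> R) : nat -> R :=
  fun n => \sum_(i < n.+1) f i * g (n - i)%N.

Definition fps_of_poly (R : comNzRingType) (q : {poly R}) : nat -> R :=
  fun n => q`_n.

Definition semigroup (m : nat) (d : 'I_m -> nat) : set nat :=
  [set s | exists a : 'I_m -> nat, s = (\sum_(i < m) a i * d i)%N]%classic.

Definition gaps (m : nat) (d : 'I_m -> nat) : set nat :=
  (~` semigroup d)%classic.

Definition hilbert_series (m : nat) (d : 'I_m -> nat) : nat -> int :=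
  fun s => (`[< semigroup d s >])%:R.

Definition is_hilbert_numerator (m : nat) (d : 'I_m -> nat) (Q : {poly int}) :=
  fps_mul (hilbert_series d) (fps_of_poly (\prod_(i < m) (1 - 'X^(d i))))
  = fps_of_poly Q.

(* The default 0 is irrelevant when gcd(d_1, ..., d_m) = 1: the numerator then
   exists, and it is unique by construction. *)
Definition hilbert_numerator (m : nat) (d : 'I_m -> nat) : {poly int} :=
  xget 0 [set Q | is_hilbert_numerator d Q]%classic.

(* As 0 ^+ 0 = 1, the convention 0^0 = 1 is built in. *)
Definition syzygy_power_sum (m : nat) (d : 'I_m -> nat) (n : nat) : int :=
  let c := 1 - hilbert_numerator d in
  \sum_(k < size c) (k : nat)%:R ^+ n * c`_k.

Definition Kp (m : nat) (d : 'I_m -> nat) (p : nat) : rat :=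
  (syzygy_power_sum d (m + p))%:~R
  / ((-1) ^+ m * (\prod_(i < m) d i)%N%:R * ((m + p)`!%:R / p`!%:R)).

(* The sum is 0 by convention over an infinite support; gcd(d_1, ..., d_m) = 1
   makes the set of gaps finite. *)
Definition gap_power_sum (m : nat) (d : 'I_m -> nat) (r : nat) : rat :=
  \sum_(g \in gaps d) (g%:R : rat) ^+ r.

Definition sigma (m : nat) (d : 'I_m -> nat) (k : nat) : rat :=
  \sum_(i < m) (d i)%:R ^+ k.

Definition delta (m : nat) (d : 'I_m -> nat) (k : nat) : rat :=
  (sigma d k - 1) / 2%:R ^+ k.

Definition exp_fps (M : nat) (x : {mpoly rat[M]}) : nat -> {mpoly rat[M]} :=
  fun k => (k`!%:R : rat)^-1 *: x ^+ k.

(* The series (e^(x t) - 1) / (x t) in t; see expm1_divE. *)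
Definition expm1_div (M : nat) (x : {mpoly rat[M]}) : nat -> {mpoly rat[M]} :=
  fun k => (k.+1`!%:R : rat)^-1 *: x ^+ k.

Lemma expm1_divE (M : nat) (x : {mpoly rat[M]}) (n : nat) :
  fps_mul (fps_of_poly (x *: 'X)) (expm1_div x) n
  = exp_fps x n - fps_one _ n.
Proof.
rewrite /fps_mul /fps_of_poly /exp_fps /expm1_div /fps_one.
case: n => [|n].
  rewrite big_ord1 coefZ coefX /= mulr0 mul0r fact0 invr1 scale1r expr0.
  by rewrite subrr.
rewrite big_ord_recl big_ord_recl /= !coefZ !coefX /= mulr0 mul0r add0r mulr1.
rewrite big1 => [|i _]; last by rewrite coefZ coefX /= mulr0 mul0r.
by rewrite addr0 /bump /= subSS subn0 subr0 -scalerAr -exprS.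
Qed.

(* The variable of index i : 'I_n of T stands for s_(i+1). *)
Definition is_universal (n : nat) (T : {mpoly rat[n]}) :=
  forall M : nat, (0 < M)%N ->
    T \mPo [tuple \sum_(j < M) ('X_j : {mpoly rat[M]}) ^+ i.+1 | i < n]
    = n`!%:R * (\big[@fps_mul _/@fps_one _]_(j < M)
                  expm1_div ('X_j : {mpoly rat[M]})) n.

(* Such a polynomial exists and is unique; the default 0 is never used. *)
Definition universal_poly (n : nat) : {mpoly rat[n]} :=
  xget 0 [set T | is_universal T]%classic.

Definition T_eval (n : nat) (s : nat -> rat) : rat :=
  (universal_poly n).@[fun i : 'I_n => s i.+1].

(* Main.v *)
(* Let A(t) be the product of the (e^(d_i t) - 1) / (d_i t), so that
   A(t) = \sum_n T_n(sigma) t^n / n!, and let Phi(z) be the generating function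
   of the gaps.  Since H_S(z) = 1/(1 - z) - Phi(z), substituting z = e^t gives
     1 - Q_S(e^t) = 1 + (-1)^m pi_m t^m A(t) (1/(e^t - 1) + Phi(e^t)),
   whose coefficient at t^(m+p) is C_(m+p) / (m+p)!.  The term A(t) Phi(e^t)
   yields the gap power sums.  The term A(t) / (e^t - 1) yields T_(p+1)(delta):
   dividing A by (e^t - 1) / t amounts to removing a "generator" 1, i.e. to
   replacing sigma_k by sigma_k - 1 = 2^k delta_k, and T_n is homogeneous of
   weight n. *)

From HB Require Import structures.
Require Import Defs.
From mathcomp Require Import all_boot all_order all_algebra.
From mathcomp Require Import boolp classical_sets fsbigop.
From mathcomp Require Import mpoly.
From mathcomp Require Import zify ring.

Import GRing.Theory Num.Theory.
Local Open Scope ring_scope.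

Set Implicit Arguments.
Unset Strict Implicit.
Unset Printing Implicit Defensive.

(** * The commutative ring of formal power series in [t] *)

Definition fps (R : comNzRingType) : Type := nat -> R.

Section FpsRing.
Variable R : comNzRingType.
Implicit Types f g h : fps R.

HB.instance Definition _ := gen_eqMixin (fps R).
HB.instance Definition _ := gen_choiceMixin (fps R).

Definition fps_add f g : fps R := fun n => f n + g n.
Definition fps_opp f : fps R := fun n => - f n.
Definition fps_zero : fps R := fun=> 0.

Fact fps_addA : associative fps_add.
Proof. by move=> f g h; apply/funext => n; apply: addrA. Qed.
Fact fps_addC : commutative fps_add.
Proof. by move=> f g; apply/funext => n; apply: addrC. Qed.
Fact fps_add0 : left_id fps_zero fps_add.
Proof. by move=> f; apply/funext => n; apply: add0r. Qed.
Fact fps_addN : left_inverse fps_zero fps_opp fps_add.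
Proof. by move=> f; apply/funext => n; apply: addNr. Qed.

HB.instance Definition _ :=
  GRing.isZmodule.Build (fps R) fps_addA fps_addC fps_add0 fps_addN.

Definition fps_trunc N f : {poly R} := \poly_(i < N) f i.

(** Coefficient [n] of a product sees only coefficients up to [n], so commutativity and
    associativity are inherited from [{poly R}]. *)
Fact fps_mul_trunc N f g n : (n < N)%N ->
  fps_mul f g n = (fps_trunc N f * fps_trunc N g)`_n.
Proof.
move=> ltnN; rewrite coefM /fps_mul; apply: eq_bigr => i _.
rewrite !coef_poly (leq_trans (ltn_ord i) ltnN).
by rewrite (leq_ltn_trans (leq_subr _ _) ltnN).
Qed.

Fact fps_mulC : commutative (@fps_mul R).
Proof.
by move=> f g; apply/funext => n; rewrite !(@fps_mul_trunc n.+1) // mulrC.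
Qed.

Fact fps_mulA : associative (@fps_mul R).
Proof.
move=> f g h; apply/funext => n; pose t := fps_trunc n.+1.
transitivity (t f * (t g * t h))`_n.
  rewrite coefM; apply: eq_bigr => i _; rewrite coef_poly ltn_ord.
  by rewrite (@fps_mul_trunc n.+1) // ltnS leq_subr.
rewrite mulrA coefM; apply: eq_bigr => i _.
by rewrite coef_poly ltnS leq_subr (@fps_mul_trunc n.+1).
Qed.

Fact fps_mul1 : left_id (@fps_one R) (@fps_mul R).
Proof.
move=> f; apply/funext => n; rewrite /fps_mul big_ord_recl big1 => [|i _].
  by rewrite addr0 mul1r subn0.
by rewrite mul0r.
Qed.

Fact fps_mulDl : left_distributive (@fps_mul R : fps R -> fps R -> fps R) +%R.
Proof.
move=> f g h; apply/funext => n; rewrite /fps_mul -[RHS]big_split /=.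
by apply: eq_bigr => i _; apply: mulrDl.
Qed.

Fact fps_1neq0 : (@fps_one R : fps R) != 0.
Proof. by apply/eqP => /(congr1 (@^~ 0%N)) /eqP; rewrite oner_eq0. Qed.

HB.instance Definition _ := GRing.Zmodule_isComNzRing.Build (fps R)
  fps_mulA fps_mulC fps_mul1 fps_mulDl fps_1neq0.

Definition fps_coef n f : R := f n.

Fact fps_coef_is_zmod_morphism n : zmod_morphism (fps_coef n).
Proof. by []. Qed.

HB.instance Definition _ n :=
  GRing.isZmodMorphism.Build (fps R) R (fps_coef n)
    (fps_coef_is_zmod_morphism n).

Lemma fpsD f g n : (f + g) n = f n + g n.
Proof. by []. Qed.

Lemma fpsB f g n : (f - g) n = f n - g n.
Proof. by []. Qed.

Lemma fps1 n : (1 : fps R) n = (n == 0%N)%:R.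
Proof. by []. Qed.

Lemma fpsM f g n : (f * g) n = \sum_(i < n.+1) f i * g (n - i)%N.
Proof. by []. Qed.

Lemma fps_sum (I : Type) (r : seq I) (P : pred I) (F : I -> fps R) n :
  (\sum_(i <- r | P i) F i) n = \sum_(i <- r | P i) F i n.
Proof. exact: (raddf_sum (fps_coef n)). Qed.

Lemma fps_intr_mul (z : int) f n : (z%:~R * f) n = z%:~R * f n.
Proof. by rewrite !mulrzl; apply: (raddfMz (fps_coef n)). Qed.

Lemma fpsM0 f g : (f * g) 0%N = f 0%N * g 0%N.
Proof. by rewrite fpsM big_ord1. Qed.

Lemma fps_prod0 (I : Type) (r : seq I) (P : pred I) (F : I -> fps R) :
  (forall i, F i 0%N = 1) -> (\prod_(i <- r | P i) F i) 0%N = 1.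
Proof.
move=> F1; elim/big_rec: _ => // i f _ f1; by rewrite fpsM0 F1 f1 mulr1.
Qed.

Lemma fpsX_lt f k n : f 0%N = 0 -> (n < k)%N -> (f ^+ k) n = 0.
Proof.
move=> f0; elim: k n => // k IHk n lt_nk.
rewrite exprS fpsM big1 // => -[[|i] /= lt_in] _; first by rewrite f0 mul0r.
by rewrite IHk ?mulr0 //; lia.
Qed.

(* The inverse is the geometric series in [1 - f]. *)
Lemma fps_inv f : f 0%N = 1 -> exists g : fps R, g * f = 1.
Proof.
move=> f1; pose u := 1 - f.
have u0 : u 0%N = 0 by rewrite /u fpsB fps1 f1 subrr.
pose s n : fps R := \sum_(k < n) u ^+ k.
(* [u ^+ k] vanishes at index [i] once [k > i], so the partial sums stabilize and their diagonal
   stands for the infinite sum. *)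
have sE n i : (i <= n)%N -> s i.+1 i = s n.+1 i.
  move=> le_in; rewrite /s !fps_sum -!(big_mkord xpredT (fun k => (u ^+ k) i)).
  rewrite (@big_cat_nat _ _ _ i.+1 0 n.+1) //= [X in _ = _ + X]big_nat_cond.
  by rewrite [X in _ = _ + X]big1 ?addr0 // => k; rewrite andbT => /andP[? _];
     apply: fpsX_lt.
exists (fun n => s n.+1 n); apply/funext => n.
transitivity ((s n.+1 * f) n).
  rewrite !fpsM; apply: eq_bigr => i _; congr (_ * _).
  by rewrite (sE n) // -ltnS.
have -> : s n.+1 * f = 1 - u ^+ n.+1.
  have -> : f = 1 - u by rewrite /u; ring.
  by rewrite -[RHS]opprB subrX1 -/(s n.+1); ring.
by rewrite fpsB fpsX_lt // subr0.
Qed.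

Definition fps_X : fps R := fun n => (n == 1%N)%:R.

Lemma fps_XM f n : (fps_X * f) n.+1 = f n.
Proof.
rewrite fpsM 2!big_ord_recl big1 => [|i _]; last by rewrite mul0r.
by rewrite mul0r mul1r add0r addr0 subn1.
Qed.

Lemma fps_XnM k f n : (fps_X ^+ k * f) (k + n)%N = f n.
Proof.
by elim: k => [|k IHk]; rewrite ?mul1r // exprS -mulrA addSn fps_XM.
Qed.

Definition fps_euler f : fps R := fun n => f n *+ n.

Lemma fps_eulerM f g : fps_euler (f * g) = fps_euler f * g + f * fps_euler g.
Proof.
apply/funext => n; rewrite fpsD /fps_euler !fpsM -big_split /= -sumrMnl.
apply: eq_bigr => i _; rewrite mulrnAl mulrnAr -mulrnDr.
by rewrite subnKC // -ltnS.
Qed.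

(** Logarithmic derivatives of a product add up; stated without division, for the derivation
    [t d/dt]. *)
Lemma fps_euler_prod (I : Type) (r : seq I) (F G : I -> fps R) :
  (forall i, fps_euler (F i) = G i * F i) ->
  fps_euler (\prod_(i <- r) F i) = (\sum_(i <- r) G i) * \prod_(i <- r) F i.
Proof.
move=> FG; elim: r => [|i r IHr].
  by rewrite !big_nil mul0r; apply/funext => -[|n]; rewrite /fps_euler ?mul0rn.
by rewrite !big_cons fps_eulerM FG IHr; ring.
Qed.

Definition fps_poly (p : {poly R}) : fps R := fps_of_poly p.

Fact fps_poly_is_zmod_morphism : zmod_morphism fps_poly.
Proof. by move=> p q; apply/funext => n; apply: coefB. Qed.

Fact fps_poly_is_monoid_morphism : monoid_morphism fps_poly.
Proof.
split; first by apply/funext => n; apply: coef1.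
by move=> p q; apply/funext => n; apply: coefM.
Qed.

HB.instance Definition _ := GRing.isZmodMorphism.Build {poly R} (fps R)
  fps_poly fps_poly_is_zmod_morphism.
HB.instance Definition _ := GRing.isMonoidMorphism.Build {poly R} (fps R)
  fps_poly fps_poly_is_monoid_morphism.

Lemma fps_poly_inj : injective fps_poly.
Proof. by move=> p q pq; apply/polyP => n; apply: (congr1 (@^~ n) pq). Qed.

Lemma fps_polyX : fps_poly 'X = fps_X.
Proof. by apply/funext => n; apply: coefX. Qed.

End FpsRing.

Lemma fps_prodE (R : comNzRingType) (I : Type) (r : seq I) (F : I -> fps R) :
  \big[@fps_mul R/@fps_one R]_(i <- r) F i = \prod_(i <- r) F i :> fps R.
Proof. by []. Qed.

(** * Change of coefficients and rescaling of the variable *)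

Definition fps_map (R S : comNzRingType) (phi : R -> S) (f : fps R) : fps S :=
  fun n => phi (f n).

Fact fps_map_is_zmod_morphism (R S : comNzRingType) (phi : {rmorphism R -> S}) :
  zmod_morphism (fps_map phi).
Proof. by move=> f g; apply/funext => n; apply: rmorphB. Qed.

Fact fps_map_is_monoid_morphism (R S : comNzRingType)
  (phi : {rmorphism R -> S}) : monoid_morphism (fps_map phi).
Proof.
split; first by apply/funext => n; apply: rmorph_nat.
move=> f g; apply/funext => n; rewrite /fps_map !fpsM rmorph_sum.
by apply: eq_bigr => i _; rewrite rmorphM.
Qed.

HB.instance Definition _ (R S : comNzRingType) (phi : {rmorphism R -> S}) :=
  GRing.isZmodMorphism.Build (fps R) (fps S) (fps_map phi)
    (fps_map_is_zmod_morphism phi).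
HB.instance Definition _ (R S : comNzRingType) (phi : {rmorphism R -> S}) :=
  GRing.isMonoidMorphism.Build (fps R) (fps S) (fps_map phi)
    (fps_map_is_monoid_morphism phi).

(** The substitution of [c t] for [t]. *)
Definition fps_scale (R : comNzRingType) (c : R) (f : fps R) : fps R :=
  fun n => c ^+ n * f n.

Lemma fps_scaleM (R : comNzRingType) (c : R) (f g : fps R) :
  fps_scale c (f * g) = fps_scale c f * fps_scale c g.
Proof.
apply/funext => n; rewrite /fps_scale !fpsM mulr_sumr; apply: eq_bigr => i _.
by rewrite mulrACA -exprD subnKC // -ltnS.
Qed.

Lemma fps_scale_scale (R : comNzRingType) (a b : R) (f : fps R) :
  fps_scale a (fps_scale b f) = fps_scale (a * b) f.
Proof. by apply/funext => n; rewrite /fps_scale mulrA exprMn. Qed.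

Lemma fps_scale1 (R : comNzRingType) (f : fps R) : fps_scale 1 f = f.
Proof. by apply/funext => n; rewrite /fps_scale expr1n mul1r. Qed.

Lemma fps_scale_prod (R : comNzRingType) (c : R) (I : Type) (r : seq I)
    (F : I -> fps R) :
  fps_scale c (\prod_(i <- r) F i) = \prod_(i <- r) fps_scale c (F i).
Proof.
apply: (big_morph _ (fps_scaleM c)).
apply/funext => -[|n]; rewrite /fps_scale fps1 /= ?mulr0 //.
by rewrite expr0 mulr1.
Qed.

(** * The universal polynomials and their values at power sums *)

Definition expm1_series : fps rat := fun n => (n.+1`!%:R)^-1.

Lemma expm1_series0 : expm1_series 0%N = 1.
Proof. by []. Qed.

Definition power_sums (n M : nat) : n.-tuple {mpoly rat[M]} :=
  [tuple \sum_(j < M) ('X_j : {mpoly rat[M]}) ^+ i.+1 | i < n].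

(* With [D = t d/dt] and [a] the series [D f / f], the product [F] of the
   [f(x_j t)] satisfies [D F = (\sum_j a(x_j t)) F], a recursion for the
   coefficients of [F] that involves the [x_j] only through power sums; here
   [f = (e^t - 1) / t]. *)
Lemma expm1_prod_rec (a : fps rat) (M n : nat)
    (F := \prod_(j < M) (expm1_div ('X_j : {mpoly rat[M]}) : fps _)) :
  a * expm1_series = fps_euler expm1_series ->
  F n.+1 = n.+1%:R^-1 *: \sum_(k < n.+1)
    a k.+1 *: ((\sum_(j < M) 'X_j ^+ k.+1) * F (n - k)%N).
Proof.
(* Since [a] has no constant term, [F n.+1] depends on strictly earlier coefficients only. *)
move=> aE; have a0 : a 0%N = 0.
  by have := congr1 (@^~ 0%N) aE; rewrite fpsM0 expm1_series0 mulr1.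
pose G (x : {mpoly rat[M]}) : fps {mpoly rat[M]} := fun k => a k *: x ^+ k.
have GE (j : 'I_M) :
    fps_euler (expm1_div 'X_j : fps _) = G 'X_j * expm1_div 'X_j.
  apply/funext => k; rewrite fpsM /G /expm1_div /fps_euler.
  transitivity ((a * expm1_series) k *: ('X_j : {mpoly rat[M]}) ^+ k).
    by rewrite aE /fps_euler scalerMnl.
  rewrite fpsM scaler_suml; apply: eq_bigr => i _.
  by rewrite -scalerAl -scalerAr scalerA -exprD subnKC // -ltnS.
have := congr1 (@^~ n.+1) (fps_euler_prod (index_enum 'I_M) GE).
rewrite -/F /fps_euler fpsM big_ord_recl fps_sum big1 => [|j _]; last first.
  by rewrite /G a0 scale0r.
rewrite mul0r add0r => FE.
apply: (@scalerI _ _ n.+1%:R); first by rewrite pnatr_eq0.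
rewrite scalerA divff ?pnatr_eq0 // scale1r scaler_nat FE.
apply: eq_bigr => k _; rewrite fps_sum /G -scaler_sumr scalerAl.
by rewrite /= /bump add1n subSS.
Qed.

(** The recursion has the same shape for every [M], so one family [U] serves all [M] at once.
    Keeping [n] fixed while [k] grows holds the induction in a single polynomial ring. *)
Lemma expm1_prod_power_sums (n k : nat) : (k <= n)%N ->
  exists U : nat -> {mpoly rat[n]}, forall i M, (i <= k)%N ->
    U i \mPo power_sums n M
    = (\prod_(j < M) (expm1_div ('X_j : {mpoly rat[M]}) : fps _)) i.
Proof.
have [b bE] := fps_inv expm1_series0.
pose a := fps_euler expm1_series * b.
have aE : a * expm1_series = fps_euler expm1_series.
  by rewrite -mulrA bE mulr1.
elim: k => [_|k IHk lt_kn].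
  exists (fun=> 1) => -[|//] M _; rewrite comp_mpoly1 fps_prod0 // => j.
  by rewrite /expm1_div expr0 invr1 scale1r.
have [U UE] := IHk (ltnW lt_kn).
(* The right-hand side of [expm1_prod_rec], with the variable of index [l] standing for the power
   sum of exponent [l.+1]. *)
pose V := (k.+1%:R : rat)^-1 *: \sum_(l < k.+1)
  a l.+1 *: ('X_(widen_ord lt_kn l) * U (k - l)%N).
exists (fun i => if i == k.+1 then V else U i) => i M.
rewrite leq_eqVlt; case: eqP => [-> _ | _ /=]; last exact: UE.
rewrite (expm1_prod_rec _ _ aE) /V comp_mpolyZ.
rewrite (raddf_sum (comp_mpoly (power_sums n M))) /=.
congr (_ *: _); apply: eq_bigr => l _; rewrite comp_mpolyZ rmorphM /=.
by rewrite UE ?leq_subr // comp_mpolyXU -tnth_nth tnth_mktuple.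
Qed.

(** Exhibiting [n!] times [U n] as a universal polynomial rules out the default of [xget]. *)
Lemma universal_polyP (n : nat) : is_universal (universal_poly n).
Proof.
rewrite /universal_poly; apply: xgetPex.
have [U UE] := expm1_prod_power_sums (leqnn n).
exists ((n`!)%:R *: U n) => M _.
by rewrite comp_mpolyZ -/(power_sums n M) UE // fps_prodE scaler_nat mulr_natl.
Qed.

(** The universal identity with its indeterminates specialized to the entries of [x]; [is_universal]
    speaks of [M > 0] only, hence the nonempty list. *)
Lemma T_eval_power_sums (n : nat) (x : seq rat) : x != [::] ->
  T_eval n (fun k => \sum_(c <- x) c ^+ k)
  = n`!%:R * (\prod_(c <- x) fps_scale c expm1_series) n.
Proof.
rewrite -size_eq0 -lt0n => x_gt0; pose v i := tnth (in_tuple x) i.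
have := congr1 (meval v) (universal_polyP n x_gt0).
rewrite comp_mpoly_meval mevalM rmorph_nat fps_prodE => E.
transitivity (universal_poly n).@[fun i =>
    (tnth (power_sums n (size x)) i).@[v]].
  apply: meval_eq => i; rewrite tnth_mktuple raddf_sum /= (big_tnth _ _ x).
  by apply: eq_bigr => j _; rewrite rmorphXn /= mevalXU.
rewrite E; congr (_ * _).
have := rmorph_prod (fps_map (meval v)) (index_enum 'I_(size x)) xpredT
  (fun j => expm1_div 'X_j : fps _).
move=> /(congr1 (@^~ n)) E'; apply: (etrans E').
rewrite (big_tnth _ _ x); congr (_ n).
apply: eq_bigr => j _; apply/funext => k.
rewrite -[LHS]/(meval v ((k.+1`!%:R : rat)^-1 *: 'X_j ^+ k)).
by rewrite mevalZ rmorphXn /= mevalXU mulrC.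
Qed.

(** Polynomial dependence on [N] is what later carries an identity from natural [N] to [N = -1]. *)
Lemma T_eval_poly (n : nat) (a b : nat -> rat) :
  exists P : {poly rat}, forall N, T_eval n (fun k => a k + N * b k) = P.[N].
Proof.
exists (mmap polyC (fun i => (a i.+1)%:P + (b i.+1)%:P * 'X)
  (universal_poly n)).
move=> N; rewrite /T_eval mevalE /mmap horner_sum; apply: eq_bigr => m _.
rewrite hornerM hornerC /mmap1 horner_prod; congr (_ * _).
by apply: eq_bigr => i _; rewrite horner_exp !hornerE [N * _]mulrC.
Qed.

Lemma poly_eq_nat (P Q : {poly rat}) :
  (forall n : nat, P.[n%:R] = Q.[n%:R]) -> P = Q.
Proof.
move=> PQ; apply/eqP; rewrite -subr_eq0; apply/eqP.
apply: (@roots_geq_poly_eq0 _ _ [seq n%:R | n <- iota 0 (size (P - Q))]).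
- by apply/allP => _ /mapP[n _ ->]; rewrite rootE !hornerE PQ subrr.
- rewrite map_inj_uniq ?iota_uniq // => i j /eqP.
  by rewrite eqr_nat => /eqP.
- by rewrite size_map size_iota.
Qed.

(* Appending [N] copies of [h] to [x] multiplies the product by the [N]-th
   power of [f(h t)]; both sides are polynomial in [N], so the rule holds at
   [N = -1] too. *)
Lemma T_eval_power_sums_sub (x : seq rat) (h : rat) : x != [::] ->
  fps_scale h expm1_series *
    (fun n => T_eval n (fun k => \sum_(c <- x) c ^+ k - h ^+ k) / n`!%:R)
  = \prod_(c <- x) fps_scale c expm1_series.
Proof.
move=> x_neq0; apply/funext => n; pose s k := \sum_(c <- x) c ^+ k.
pose tau N k := T_eval k (fun k => s k + N * h ^+ k) / k`!%:R.
have tau_nat (N : nat) k : tau N%:R k =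
    (fps_scale h expm1_series ^+ N * \prod_(c <- x) fps_scale c expm1_series) k.
  have := @T_eval_power_sums k (nseq N h ++ x).
  rewrite -size_eq0 size_cat addn_eq0 [size x == _]size_eq0.
  rewrite (negPf x_neq0) andbF.
  move=> /(_ isT) E; rewrite /tau.
  have -> : (fun k => s k + N%:R * h ^+ k)
      = (fun k => \sum_(c <- nseq N h ++ x) c ^+ k).
    apply/funext => i; rewrite big_cat big_nseq /= addrC.
    by rewrite iter_addr addr0 mulr_natl.
  rewrite E mulrAC divff ?mul1r ?pnatr_eq0 -?lt0n ?fact_gt0 //.
  by rewrite big_cat big_nseq /= iter_mulr mulr1.
have tau_poly k : exists P : {poly rat}, forall N, tau N k = P.[N].
  have [P PE] := T_eval_poly k s (fun k => h ^+ k).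
  by exists ((k`!%:R)^-1 *: P) => N; rewrite /tau PE hornerZ mulrC.
have [P PE] := choice tau_poly.
pose L := \sum_(i < n.+1) fps_scale h expm1_series i *: P (n - i)%N.
have LE N : L.[N]
    = \sum_(i < n.+1) fps_scale h expm1_series i * tau N (n - i)%N.
  by rewrite horner_sum; apply: eq_bigr => i _; rewrite hornerZ PE.
(* Multiplying by the series of [h] raises [N] by one; this is known at every natural [N], hence as
   an identity of polynomials. *)
have E : L = P n \Po ('X + 1).
  apply: poly_eq_nat => N; rewrite horner_comp !hornerE LE -PE.
  rewrite natr1 tau_nat exprS -mulrA fpsM.
  by apply: eq_bigr => i _; rewrite tau_nat.
(* At [N = -1] the shifted argument is 0, where [tau] gives the product over [x] alone. *)
have := congr1 (horner^~ (-1)) E.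
rewrite /= horner_comp !hornerE LE addNr -PE -[0]/(0%:R) tau_nat mul1r => <-.
rewrite fpsM; apply: eq_bigr => i _; congr (_ * (_ / _)).
by congr (T_eval _ _); apply/funext => k; rewrite mulN1r.
Qed.

(** * Finiteness of the gap set *)

Section Gaps.
Variables (m : nat) (d : 'I_m -> nat).
Hypothesis d_gt0 : forall i, (0 < d i)%N.
Hypothesis d_gcd1 : (\big[gcdn/0%N]_(i < m) d i)%N = 1%N.

Lemma semigroup0 : semigroup d 0%N.
Proof. by exists (fun=> 0%N); rewrite big1. Qed.

Lemma semigroupD s t : semigroup d s -> semigroup d t -> semigroup d (s + t)%N.
Proof.
move=> [a ->] [b ->]; exists (fun i => a i + b i)%N.
by rewrite -big_split; apply: eq_bigr => i _; rewrite mulnDl.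
Qed.

Lemma semigroupM k s : semigroup d s -> semigroup d (k * s)%N.
Proof.
move=> [a ->]; exists (fun i => k * a i)%N.
by rewrite big_distrr; apply: eq_bigr => i _; rewrite /= mulnA.
Qed.

Lemma semigroup_gen i : semigroup d (d i).
Proof.
exists (fun j => nat_of_bool (j == i)); rewrite (bigD1 i) //= eqxx mul1n.
by rewrite big1 ?addn0 // => j /negPf ->.
Qed.

(** A Bezout relation without subtraction: the gcd is a difference of two elements of the
    semigroup. *)
Lemma semigroup_bezout (r : seq 'I_m) :
  exists s, semigroup d s /\ semigroup d (s + \big[gcdn/0%N]_(i <- r) d i)%N.
Proof.
elim: r => [|i r [s [ds dt]]].
  by exists 0%N; rewrite big_nil; split; apply: semigroup0.
rewrite big_cons; set g := (\big[_/_]_(_ <- r) _)%N in dt *.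
case: (egcdnP g (d_gt0 i)) => k l E _.
(* Here [k * d i = l * g + gcdn (d i) g]. Adding [l * s] to both sides replaces [l * g], which may
   lie outside the semigroup, by [l * (s + g)], which lies in it. *)
exists (l * (s + g))%N; split; first exact: semigroupM.
have -> : (l * (s + g) + gcdn (d i) g = k * d i + l * s)%N by rewrite E; lia.
by apply: semigroupD; apply: semigroupM => //; apply: semigroup_gen.
Qed.

(** The semigroup contains consecutive [s] and [s + 1]. If [s = 0] it contains 1; otherwise
    [n >= s^2] has quotient [q >= s] and remainder [u < s] by [s], and
    [n = (q - u) s + u (s + 1)]. *)
Lemma semigroup_cofinite : exists N, forall n, (N <= n)%N -> semigroup d n.
Proof.
have [s [ds dt]] := semigroup_bezout (index_enum 'I_m).
rewrite d_gcd1 addn1 in dt; case: (posnP s) => [s0 | s_gt0].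
  rewrite s0 in dt; exists 0%N => n _.
  by rewrite -[n]muln1; apply: semigroupM.
exists (s * s)%N => n le_n.
have le_q : (s <= n %/ s)%N by rewrite leq_divRL.
have lt_r : (n %% s < s)%N by rewrite ltn_mod.
have -> : n = ((n %/ s - n %% s) * s + (n %% s) * s.+1)%N.
  rewrite {1}(divn_eq n s); set q := (n %/ s)%N in le_q *.
  set u := (n %% s)%N in lt_r *; nia.
by apply: semigroupD; apply: semigroupM.
Qed.

Lemma gaps_seq : exists2 r : seq nat, uniq r & gaps d = [set` r]%classic.
Proof.
have [N dN] := semigroup_cofinite.
exists [seq g <- iota 0 N | `[< gaps d g >]].
  by rewrite filter_uniq ?iota_uniq.
apply/seteqP; split=> g /=; rewrite mem_filter mem_iota add0n /=.
  move=> gg; apply/andP; split; first exact/asboolP.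
  by rewrite ltnNge; apply/negP => /dN.
by move=> /andP[/asboolP].
Qed.

End Gaps.

(** * Hilbert series and numerator in terms of the gaps *)

Lemma hilbert_series_gaps (m : nat) (d : 'I_m -> nat) (r : seq nat) :
  uniq r -> gaps d = [set` r]%classic ->
  (1 - fps_X int) * hilbert_series d
  = fps_poly (1 - (1 - 'X) * \sum_(g <- r) 'X^g).
Proof.
(* The constant sequence 1 is the series [1 / (1 - z)]. *)
move=> r_uniq dr; have -> : hilbert_series d
    = ((fun=> 1) : fps int) - fps_poly (\sum_(g <- r) 'X^g).
  apply/funext => n; rewrite fpsB /fps_poly /fps_of_poly coef_sum.
  under eq_bigr => g _ do rewrite coefXn.
  have <- : ((n \in r)%:R : int) = \sum_(g <- r) (n == g)%:R.
    have [n_r|n_r] := boolP (n \in r).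
      rewrite (bigD1_seq n) //= eqxx big1 ?addr0 // => g.
      by rewrite eq_sym => /negPf ->.
    rewrite big_seq big1 // => g g_r.
    by case: eqP n_r => // ->; rewrite g_r.
  have -> : (n \in r) = ~~ `[< semigroup d n >].
    apply/idP/idP => [n_r | /asboolPn n_d].
      by apply/asboolPn; change (gaps d n); rewrite dr.
    by have : gaps d n := n_d; rewrite dr.
  by rewrite /hilbert_series; case: asboolP.
rewrite mulrBr rmorphB rmorphM rmorphB rmorph1 /= fps_polyX; congr (_ - _).
apply/funext => -[|n]; first by rewrite fpsM0 fpsB mulr1.
by rewrite mulrBl mul1r fpsB fps_XM fps1 subrr.
Qed.

(* The generating function of the gaps is [1 / (1 - z) - H(z)], so clearing
   denominators expresses [Q] through it. *)
Lemma hilbert_numerator_gaps (m : nat) (d : 'I_m -> nat) (r : seq nat) :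
  (0 < m)%N -> uniq r -> gaps d = [set` r]%classic ->
  (1 - 'X) * hilbert_numerator d
  = (1 - (1 - 'X) * \sum_(g <- r) 'X^g) * \prod_(i < m) (1 - 'X^(d i)).
Proof.
move=> m_gt0 r_uniq dr; have HE := hilbert_series_gaps r_uniq dr.
set D := \prod_(i < m) _; set Phi := \sum_(g <- r) _ in HE *.
(* As [m > 0], [D] vanishes at 1 and [D / (1 - z) = - q] is a polynomial. Hence so is
   [H D = - q - Phi * D], and a numerator exists. *)
have [q Dq] : exists q, D = q * ('X - 1%:P).
  apply/factor_theorem; rewrite rootE horner_prod.
  by rewrite (bigD1 (Ordinal m_gt0)) //= !hornerE expr1n subrr mul0r.
have HD : (hilbert_series d : fps int) * fps_poly D = fps_poly (- q - Phi * D).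
  have -> : - q - Phi * D = (1 - (1 - 'X) * Phi) * - q.
    by rewrite Dq polyC1; ring.
  have {1}-> : D = (1 - 'X) * - q by rewrite Dq polyC1; ring.
  rewrite [in RHS]rmorphM /= -HE rmorphM rmorphB rmorph1 /= fps_polyX.
  by rewrite mulrA [_ * (1 - _)]mulrC.
have numP : (hilbert_series d : fps int) * fps_poly D
    = fps_poly (hilbert_numerator d).
  apply: (@xgetPex _ _ [set Q | is_hilbert_numerator d Q]%classic).
  by exists (- q - Phi * D).
apply: fps_poly_inj; rewrite !rmorphM /= -numP -HE mulrA.
by rewrite rmorphB rmorph1 /= fps_polyX.
Qed.

(** * The substitution [z = e^t] *)

Definition fps_exp (c : rat) : fps rat := fun n => c ^+ n / n`!%:R.

Lemma fps_expD (a b : rat) : fps_exp (a + b) = fps_exp a * fps_exp b.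
Proof.
apply/funext => n; rewrite fpsM /fps_exp addrC exprDn mulr_suml.
apply: eq_bigr => i _; have le_in : (i <= n)%N by rewrite -ltnS.
rewrite -(bin_fact le_in) !natrM -mulr_natr.
have f_neq0 k : (k`!%:R : rat) != 0 by rewrite pnatr_eq0 -lt0n fact_gt0.
have c_neq0 : ('C(n, i)%:R : rat) != 0 by rewrite pnatr_eq0 -lt0n bin_gt0.
by field; rewrite !f_neq0 c_neq0.
Qed.

Lemma fps_expX (c : rat) k : fps_exp c ^+ k = fps_exp (k%:R * c).
Proof.
elim: k => [|k IHk].
  rewrite mul0r expr0; apply/funext => -[|n]; rewrite fps1 /fps_exp //.
  by rewrite expr0n mul0r.
by rewrite exprS IHk -fps_expD -natr1 mulrDl mul1r addrC.
Qed.

(** Splits [1 - e^(c t)] into [- c t] and a series of constant term 1; over all generators the first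
    factors collect into [(-1)^m pi_m t^m]. *)
Lemma fps_1Bexp (c : rat) n :
  (1 - fps_exp c) n = - (c * (fps_X rat * fps_scale c expm1_series) n).
Proof.
case: n => [|n].
  by rewrite fpsB fps1 fpsM0 /fps_exp mul0r mulr0 oppr0 expr0 divr1 subrr.
by rewrite fpsB fps1 fps_XM /fps_exp /fps_scale sub0r exprS mulrA.
Qed.

Definition exp_subst (q : {poly int}) : fps rat :=
  (map_poly intr q).[fps_exp 1].

Lemma exp_substM (p q : {poly int}) :
  exp_subst (p * q) = exp_subst p * exp_subst q.
Proof. by rewrite /exp_subst rmorphM hornerM. Qed.

Lemma exp_subst1 : exp_subst 1 = 1.
Proof. by rewrite /exp_subst rmorph1 hornerE. Qed.

Lemma exp_substB (p q : {poly int}) :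
  exp_subst (p - q) = exp_subst p - exp_subst q.
Proof. by rewrite /exp_subst rmorphB !hornerE. Qed.

Lemma exp_substXn k : exp_subst 'X^k = fps_exp k%:R.
Proof. by rewrite /exp_subst map_polyXn hornerXn fps_expX mulr1. Qed.

Lemma exp_subst_sum (r : seq nat) (F : nat -> {poly int}) :
  exp_subst (\sum_(g <- r) F g) = \sum_(g <- r) exp_subst (F g).
Proof. by rewrite /exp_subst rmorph_sum horner_sum. Qed.

(** The coefficient of [t^n] in [e^(k t)] is [k^n / n!]. For [q = 1 - Q] the sum is
    [syzygy_power_sum]. *)
Lemma exp_subst_coef (q : {poly int}) n :
  exp_subst q n
  = (\sum_(k < size q) (k : nat)%:R ^+ n * q`_k)%:~R / n`!%:R.
Proof.
rewrite /exp_subst /map_poly horner_poly fps_sum rmorph_sum mulr_suml.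
apply: eq_bigr => k _; rewrite fps_expX mulr1 fps_intr_mul /fps_exp.
by rewrite rmorphM rmorphXn rmorph_nat /=; ring.
Qed.

(** * Values at [sigma] and [delta], and comparison of coefficients *)

Section PowerSums.
Variables (m : nat) (d : 'I_m -> nat).
Hypothesis m_gt0 : (0 < m)%N.

Let A : fps rat := \prod_(i < m) fps_scale (d i)%:R expm1_series.

(** Used with [c = 1] for [sigma] and [c = 1/2] for [delta]. *)
Fact gen_seq_neq0 (c : rat) : [seq (d i)%:R * c | i <- index_enum 'I_m] != [::].
Proof.
by rewrite -size_eq0 size_map [index_enum _]unlock -enumT size_enum_ord -lt0n.
Qed.

Lemma T_eval_sigma n : T_eval n (sigma d) / n`!%:R = A n.
Proof.
have := T_eval_power_sums n (gen_seq_neq0 1).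
have -> : (fun k =>
    \sum_(c <- [seq (d i)%:R * 1 | i <- index_enum 'I_m]) c ^+ k) = sigma d.
  by apply/funext => k; rewrite big_map; apply: eq_bigr => i _; rewrite mulr1.
move=> ->; rewrite mulrAC divff ?mul1r ?pnatr_eq0 -?lt0n ?fact_gt0 //.
by rewrite big_map /A; congr (_ n); apply: eq_bigr => i _; rewrite mulr1.
Qed.

(** [delta_k] is the power sum of the [d_i / 2] minus [(1/2)^k], so [T_eval_power_sums_sub] applies
    with [h = 1/2]. Rescaling [t] by 2 then clears the halves and produces [2^n], in place of
    homogeneity of [T_n]. *)
Lemma T_eval_delta :
  expm1_series * (fun n => 2%:R ^+ n * T_eval n (delta d) / n`!%:R) = A.
Proof.
have := T_eval_power_sums_sub 2%:R^-1 (gen_seq_neq0 2%:R^-1).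
move/(congr1 (fps_scale 2%:R)).
rewrite fps_scaleM fps_scale_scale fps_scale_prod big_map.
rewrite divff ?pnatr_eq0 // fps_scale1.
under eq_bigr => i _ do
  rewrite fps_scale_scale mulrCA divff ?pnatr_eq0 // mulr1.
rewrite -/A => <-; congr (_ * _); apply/funext => n; rewrite /fps_scale mulrA.
congr (_ * T_eval _ _ / _); apply/funext => k.
rewrite big_map /delta /sigma exprVn mulrBl mul1r mulr_suml; congr (_ - _).
by apply: eq_bigr => i _; rewrite exprMn exprVn.
Qed.

Lemma exp_subst_denominator :
  exp_subst (\prod_(i < m) (1 - 'X^(d i)))
  = ((-1) ^+ m * (\prod_(i < m) d i)%N%:R : int)%:~R * (fps_X rat ^+ m * A).
Proof.
rewrite /A; elim: m d => [|k IHk] e.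
  by rewrite !big_ord0 exp_subst1 !mulr1.
rewrite !big_ord_recr /= exp_substM IHk exp_substB exp_subst1 exp_substXn.
have -> : 1 - fps_exp (e ord_max)%:R = (- (e ord_max)%:R : int)%:~R *
    (fps_X rat * fps_scale (e ord_max)%:R expm1_series).
  apply/funext => n; rewrite fps_1Bexp fps_intr_mul rmorphN mulNr.
  by rewrite rmorph_nat.
by rewrite natrM !rmorphM !rmorphN /= !exprS; ring.
Qed.

(* Substituting [z = e^t] in the equation for [Q] and comparing coefficients
   of [t^(m+p+1)]. *)
Lemma syzygy_power_sum_gaps (r : seq nat) (p : nat) :
  uniq r -> gaps d = [set` r]%classic ->
  (syzygy_power_sum d (m + p))%:~R / (m + p)`!%:R
  = (-1) ^+ m * (\prod_(i < m) d i)%N%:R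
    * (2%:R ^+ p.+1 * T_eval p.+1 (delta d) / p.+1`!%:R
       + (exp_subst (\sum_(g <- r) 'X^g) * A) p).
Proof.
move=> r_uniq dr; rewrite -exp_subst_coef exp_substB fpsB exp_subst1 fps1.
(* Since [m + p > 0], the constant 1 of [1 - Q] does not contribute. *)
rewrite addn_eq0 eqn0Ngt m_gt0 /= sub0r.
have := congr1 exp_subst (hilbert_numerator_gaps m_gt0 r_uniq dr).
rewrite !exp_substM exp_subst_denominator !exp_substB exp_substM exp_substB.
rewrite exp_subst1 -['X]expr1 exp_substXn.
set c : int := (_ * _); set Q := exp_subst _; set Phi := exp_subst _.
have -> : 1 - fps_exp 1%:R = - (fps_X rat * expm1_series).
  by apply/funext => n; rewrite fps_1Bexp mul1r fps_scale1.
pose tau : fps rat := fun n => 2%:R ^+ n * T_eval n (delta d) / n`!%:R.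
have [b bE] := fps_inv expm1_series0 => E.
(* Multiplying by [b] cancels the invertible part of [1 - e^t]; the remaining factor [t] shifts the
   index to [m + p + 1]. *)
have {}E : fps_X rat * - Q
    = c%:~R * (fps_X rat ^+ m * (tau + fps_X rat * (Phi * A))).
  have -> : fps_X rat * - Q = b * (- (fps_X rat * expm1_series) * Q).
    by rewrite -[LHS]mul1r -bE; ring.
  have tauE : tau = b * A by rewrite -T_eval_delta mulrA bE mul1r.
  have PhiE : Phi * A = b * expm1_series * (Phi * A) by rewrite bE mul1r.
  by rewrite E tauE PhiE; ring.
rewrite -[LHS]/((- Q) (m + p)%N); have := congr1 (@^~ (m + p).+1) E.
rewrite fps_XM fps_intr_mul -addnS fps_XnM fpsD fps_XM => ->.
by rewrite rmorphM rmorphXn rmorphN1 rmorph_nat.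
Qed.

End PowerSums.
Theorem theorem1p11 (m : nat) (d : 'I_m -> nat)
    (m_ge1 : (1 <= m)%N)
    (d_gt0 : forall i : 'I_m, (0 < d i)%N)
    (d_gcd1 : (\big[gcdn/0%N]_(i < m) d i)%N = 1%N)
    (p : nat) :
  Kp d p =
    \sum_(r < p.+1)
       'C(p, r)%:R * T_eval (p - r) (sigma d) * gap_power_sum d r
    + 2%:R ^+ p.+1 / p.+1%:R * T_eval p.+1 (delta d).
Proof.
have [r r_uniq dr] := gaps_seq d_gt0 d_gcd1.
have f_neq0 k : (k`!%:R : rat) != 0 by rewrite pnatr_eq0 -lt0n fact_gt0.
set c : rat := (-1) ^+ m * (\prod_(i < m) d i)%N%:R.
have c_neq0 : c != 0.
  rewrite mulf_neq0 ?expf_neq0 ?oppr_eq0 ?oner_eq0 // pnatr_eq0 -lt0n.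
  exact: prodn_gt0.
have -> : Kp d p
    = p`!%:R / c * ((syzygy_power_sum d (m + p))%:~R / (m + p)`!%:R).
  by rewrite /Kp -/c; field; rewrite !f_neq0 c_neq0.
rewrite (syzygy_power_sum_gaps m_ge1 p r_uniq dr) -/c.
rewrite mulrA divfK // mulrDr addrC; congr (_ + _); last first.
  have p_neq0 : (1 + p%:R : rat) != 0 by rewrite nat1r pnatr_eq0.
  by rewrite factS natrM; field; rewrite f_neq0 p_neq0.
rewrite fpsM mulr_sumr; apply: eq_bigr => i _.
have le_ip : (i <= p)%N by rewrite -ltnS.
rewrite -T_eval_sigma // exp_subst_sum fps_sum.
(* The gap series at [e^t] is the exponential generating function of the gap power sums; with [p!]
   in front, the factorials form the binomial coefficient. *)
have -> : \sum_(g <- r) exp_subst 'X^g i = gap_power_sum d i / i`!%:R.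
  rewrite /gap_power_sum dr -fsbig_seq // mulr_suml.
  by apply: eq_bigr => g _; rewrite exp_substXn.
rewrite -(bin_fact le_ip) !natrM; field.
by rewrite !f_neq0.
Qed.
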